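(* Let $Y$ be an extremally disconnected space and let $X\subset Y$ be a subspace which is $\mathrm{I}$-favorable. Then $X$ is also extremally disconnected.
   Context: All topological spaces are Tychonoff and non-empty. A space is extremally disconnected if the closure of every open subset is open. $\mathrm{I}$-favorable: $X$ is $\mathrm{I}$-favorable if player I has a winning strategy in the open-open game, i.e. there is a function $\sigma$ assigning to every finite (possibly empty) sequence of non-empty open subsets of $X$ a non-empty open subset of $X$, such that for every sequence $(U_k)_{k\ge 0}$ of non-empty open subsets of $X$ with $U_0\subset\sigma(\varnothing)$ and $U_{k+1}\subset\sigma(U_0,\dots,U_k)$ for all $k\ge 0$, the union $\bigcup_{k\ge 0}U_k$ is dense in $X$. *)

(* Defs.v *)
From HB Require Import structures.
From mathcomp Require Import all_boot all_order all_algebra.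
From mathcomp Require Import all_classical all_reals topology.
From mathcomp Require Import normedtype.

Set Implicit Arguments.
Unset Strict Implicit.
Unset Printing Implicit Defensive.

Local Open Scope classical_set_scope.

(* [completely_regular_space] separates points from closed sets by uniformities;
   [uniform_separatorP] turns this into continuous maps to [0, 1]. *)
Definition tychonoff_space (T : topologicalType) : Prop :=
  completely_regular_space T /\ hausdorff_space T.

Definition extremally_disconnected (T : topologicalType) : Prop :=
  forall U : set T, open U -> open (closure U).

(* The moves of the open-open game; as a set of sets, it is also usable as the
   type of its elements through the coercion [set_type]. *)
Definition nonempty_open (T : topologicalType) : set (set T) :=
  [set U | open U /\ U !=set0].
Arguments nonempty_open : clear implicits.

(* [mkseq U k.+1] is the list [:: U 0; ...; U k] of the moves of player II. *)
Definition winning_strategy (T : topologicalType)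
    (sigma : seq (nonempty_open T) -> nonempty_open T) : Prop :=
  forall U : nat -> nonempty_open T,
    set_val (U 0%N) `<=` set_val (sigma [::]) ->
    (forall k : nat, set_val (U k.+1) `<=` set_val (sigma (mkseq U k.+1))) ->
    dense (\bigcup_k set_val (U k)).

Definition I_favorable (T : topologicalType) : Prop :=
  exists sigma : seq (nonempty_open T) -> nonempty_open T,
    winning_strategy sigma.

(* Main.v *)
Require Import Defs.
From mathcomp Require Import all_boot all_order all_algebra.
From mathcomp Require Import all_classical all_reals topology.
From mathcomp Require Import normedtype.

Set Implicit Arguments.
Unset Strict Implicit.

Local Open Scope classical_set_scope.

(** Two facts combine.

    In an I-favorable space, every pi-base has a countable subfamily with dense
    union ([I_favorable_countable_dense]): player II may always answer with a
    member of the pi-base, and already one such play has dense union. This is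
    a form of the countable chain condition.

    Consider two sequences of open sets [A k], [B k] such that the closure of
    each member of one avoids, inside a subset [X], all members of the other.
    Their unions may overlap outside [X], but they contain disjoint open sets
    with the same traces on [X] ([openD_head], [disjoint_openD_head]):
    subtract from [A k] the closures of the [B m] with [m <= k], and
    symmetrically. The enumeration is what keeps these differences open, since
    only finitely many closures are removed at a time.

    Let [U] be open in [X] and let [V] be the complement in [X] of its closure.
    By regularity of the ambient space [Y], the traces on [X] of the open sets
    of [Y] whose closure meets [X] only inside [U], or only inside [V], contain
    a pi-base of [X]. Hence countably many of them have dense union, and they
    yield disjoint open sets [G] and [H] of [Y] whose traces are dense in [U]
    and in [V] respectively. As [Y] is extremally disconnected, the closures of
    [G] and [H] are disjoint, so that the closure of [U] in [X] is the trace of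
    the closure of [G], which is open. *)

(** * Countable dense subfamilies in I-favorable spaces *)

(** Player II answers a winning strategy by members of the pi-base [B]. Each
    answer depends on the earlier ones, so the play is built by recursion on
    its history. *)
Lemma I_favorable_countable_dense {T : topologicalType} (B : set (set T)) :
    I_favorable T ->
    (forall W : set T, open W -> W !=set0 ->
      exists O, [/\ B O, open O, O !=set0 & O `<=` W]) ->
  exists O : nat -> set T, (forall k, B (O k)) /\ dense (\bigcup_k O k).
Proof.
move=> [sigma sigma_wins] piB.
have reply (W : nonempty_open T) :
    {O : nonempty_open T | B (set_val O) /\ set_val O `<=` set_val W}.
  apply: cid; have [oW W0] := set_valP W.
  have [O [BO oO O0 OW]] := piB (set_val W) oW W0.
  by exists (exist _ O (mem_set (conj oO O0))).
pose move_after s := sval (reply (sigma s)).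
pose history n := iter n (fun s => rcons s (move_after s)) [::].
pose U k := move_after (history k).
have historyE n : history n = mkseq U n.
  by elim: n => [//|n IH]; rewrite mkseqS -IH.
have Usigma k : set_val (U k) `<=` set_val (sigma (mkseq U k)).
  by rewrite -historyE; exact: (svalP (reply _)).2.
exists (fun k => set_val (U k)); split.
  by move=> k; exact: (svalP (reply _)).1.
by apply: sigma_wins => [|k]; exact: Usigma.
Qed.

(** * Disjoint shrinkings of two sequences of open sets *)

Definition openD_head {T : topologicalType} (A B : nat -> set T) : set T :=
  \bigcup_k (A k `\` \bigcup_(m in `I_k.+1) closure (B m)).

Lemma open_openD_head {T : topologicalType} (A B : nat -> set T) :
  (forall k, open (A k)) -> open (openD_head A B).
Proof.
move=> oA; apply: bigcup_open => k _; rewrite setDE; apply: openI => //.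
apply/closed_openC/closed_bigcup; first exact: finite_II.
by move=> m _; exact: closed_closure.
Qed.

(** A common point would lie in some [A k] and some [B m]; the smaller of the
    two indices was removed from the set with the larger one. *)
Lemma disjoint_openD_head {T : topologicalType} (A B : nat -> set T) :
  openD_head A B `&` openD_head B A = set0.
Proof.
rewrite -subset0 => y [[k _ [Ay nBy]] [m _ [By nAy]]].
have [mk|/ltnW km] := leqP m k.
- by apply: nBy; exists m => //; exact: subset_closure.
- by apply: nAy; exists k => //; exact: subset_closure.
Qed.

Lemma mem_openD_head {T : topologicalType} (A B : nat -> set T) (y : T) k :
  A k y -> (forall m, ~ closure (B m) y) -> openD_head A B y.
Proof. by move=> Ay nBy; exists k => //; split=> // -[m _]; exact: nBy. Qed.

(** * Extremally disconnected spaces *)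

Lemma open_disjoint_closure {T : topologicalType} (G H : set T) :
  open G -> G `&` H = set0 -> G `&` closure H = set0.
Proof.
move=> oG GH0; rewrite -subset0 => y [Gy /(_ G)].
rewrite setIC GH0 => -[]; last by [].
exact: open_nbhs_nbhs.
Qed.

(** Disjointness passes to [closure G] because [H] is open, and then to
    [closure H] because [closure G] is open. *)
Lemma extremally_disconnected_closure {T : topologicalType} (G H : set T) :
  extremally_disconnected T -> open G -> open H -> G `&` H = set0 ->
  closure G `&` closure H = set0.
Proof.
move=> edT oG oH GH0; apply: open_disjoint_closure; first exact: edT.
by rewrite setIC; apply: open_disjoint_closure => //; rewrite setIC.
Qed.

(** * Open sets of the ambient space and their traces on a subspace *)

(** Regularity of a Tychonoff space: an entourage separating [x] from the
    complement of [W] is split in two, and the section at [x] of one half has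
    its closure inside the section of the whole. *)
Lemma tychonoff_open_shrink {T : topologicalType} (x : T) (W : set T) :
  tychonoff_space T -> open W -> W x ->
  exists G, [/\ open G, G x & closure G `<=` W].
Proof.
move=> [crT _] oW Wx.
have [uT [E [entE sepE coarse]]] :=
  crT x _ (open_closedC oW) (fun nWx => nWx Wx).
pose UT : uniformType := Uniform.Pack uT.
pose N : set T := xsection (@split_ent UT E) x.
exists N°; split; first exact: open_interior.
  by apply: coarse; exact: (@nbhs_entourage UT).
(* The uniformity is coarser than the topology of [T], so it gives larger
   closures. *)
move=> y Ny; have /(@ent_closure UT _ _ entE) /xsectionP Exy : @closure UT N y.
  move=> M /coarse /Ny [z [/interior_subset Nz Mz]].
  by exists z.
apply: contrapT => nWy.
by have : ([set x] `*` ~` W `&` E) (x, y) by []; rewrite sepE.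
Qed.

Section Subspace.
Context {Y : topologicalType} {X : set Y}.

Lemma open_trace (G : set Y) :
  open G -> open ((@set_val Y X) @^-1` G).
Proof. by move=> oG; exists G. Qed.

Lemma closure_trace (G : set Y) :
  closure ((@set_val Y X) @^-1` G) `<=` set_val @^-1` closure G.
Proof.
move=> x clx N /nbhs_interior Nx.
have [] := clx ((@set_val Y X) @^-1` N°).
  apply: open_nbhs_nbhs; split; first exact/open_trace/open_interior.
  exact: (nbhs_singleton Nx).
by move=> z [Gz /interior_subset Nz]; exists (set_val z).
Qed.

(** The closure of [U] is the trace of the open set [closure G]: a point of
    that trace outside [closure U] would also lie in [closure H], which is
    disjoint from [closure G]. *)
Lemma open_closure_of_separation (U : set X) (G H : set Y) :
    extremally_disconnected Y -> open G -> open H -> G `&` H = set0 ->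
    U `<=` set_val @^-1` closure G ->
    ~` closure U `<=` set_val @^-1` closure H ->
  open (closure U).
Proof.
move=> edY oG oH GH0 UG VH.
suff -> : closure U = set_val @^-1` closure G by exact/open_trace/edY.
apply/seteqP; split=> [x clUx|x Gx].
  have := closure_trace (closureS UG clUx).
  by rewrite /= -(closure_id (closure G)).1 //; exact: closed_closure.
apply: contrapT => /VH Hx.
have : (closure G `&` closure H) (set_val x) by [].
by rewrite (extremally_disconnected_closure edY oG oH GH0).
Qed.

Definition closure_within (W : set X) (G : set Y) : Prop :=
  set_val @^-1` closure G `<=` W.

Lemma closure_within_exists (W : set X) (x : X) :
  tychonoff_space Y -> open W -> W x ->
  exists G, [/\ open G, G (set_val x) & closure_within W G].
Proof.
move=> tY [W' oW' <-] Wx.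
have [G [oG Gx GW']] := tychonoff_open_shrink tY oW' Wx.
by exists G; split=> // z; exact: GW'.
Qed.

Lemma closure_within0 (W : set X) : closure_within W set0.
Proof. by rewrite /closure_within closure0. Qed.

(** Shrinking [A] by the closures of the [B m] loses no point of [U], since
    these closures meet [X] only inside [V]. *)
Lemma sub_closure_openD_head (U V D : set X) (A B : nat -> set Y) :
    open U -> U `&` V = set0 -> dense D ->
    (forall x, D x -> U x -> exists k, A k (set_val x)) ->
    (forall m, closure_within V (B m)) ->
  U `<=` set_val @^-1` closure (openD_head A B).
Proof.
move=> oU UV0 dD DA BV x Ux N /nbhs_interior Nx.
have [||z [[Uz /interior_subset Nz] Dz]] := dD (U `&` set_val @^-1` N°).
- by exists x; split=> //; exact: (nbhs_singleton Nx).
- by apply: openI => //; exact/open_trace/open_interior.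
have [k Az] := DA z Dz Uz.
exists (set_val z); split=> //; apply: (mem_openD_head Az) => // m Bz.
by have : (U `&` V) z by [split=> //; exact: BV Bz]; rewrite UV0.
Qed.

End Subspace.

Theorem corollary1p2 (Y : topologicalType) (X : set Y)
    (Y_nonempty : [set: Y] !=set0) (Y_tychonoff : tychonoff_space Y)
    (Y_ed : extremally_disconnected Y)
    (X_nonempty : X !=set0) (X_favorable : I_favorable (set_type X)) :
  extremally_disconnected (set_type X).
Proof.
move=> U oU; pose V := ~` closure U.
have oV : open V by exact/closed_openC/closed_closure.
have UV0 : U `&` V = set0.
  by rewrite -subset0 => x [/subset_closure].
(* The pi-base below uses only pairs with an empty component; indexing it by
   pairs yields the two sequences to be separated at once, padded by empty
   sets. *)
pose trapped (AB : set Y * set Y) := [/\ open AB.1, open AB.2,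
  closure_within U AB.1 & closure_within V AB.2].
pose trace (AB : set Y * set Y) : set X := set_val @^-1` (AB.1 `|` AB.2).
have [|O [trapO dO]] :=
    I_favorable_countable_dense (B := trace @` trapped) X_favorable.
  move=> W oW [x Wx]; have [Ux|Vx] := pselect (closure U x).
  - have [y [Uy Wy]] := Ux W (open_nbhs_nbhs (conj oW Wx)).
    have [||G [oG Gy GUW]] :=
        closure_within_exists (W := U `&` W) (x := y) Y_tychonoff.
    + exact: openI.
    + by [].
    have tr : trace (G, set0) = set_val @^-1` G by rewrite /trace /= setU0.
    exists (trace (G, set0)); split.
    + exists (G, set0) => //; split=> //=; first exact: open0.
      * by move=> z /GUW[].
      * exact: closure_within0.
    + by rewrite tr; exact: open_trace.
    + by rewrite tr; exists y.
    + by rewrite tr => z /= /subset_closure Gz; have [] := GUW z Gz.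
  - have [||G [oG Gx GVW]] :=
        closure_within_exists (W := V `&` W) (x := x) Y_tychonoff.
    + exact: openI.
    + by [].
    have tr : trace (set0, G) = set_val @^-1` G by rewrite /trace /= set0U.
    exists (trace (set0, G)); split.
    + exists (set0, G) => //; split=> //=; first exact: open0.
      * exact: closure_within0.
      * by move=> z /GVW[].
    + by rewrite tr; exact: open_trace.
    + by rewrite tr; exists x.
    + by rewrite tr => z /= /subset_closure Gz; have [] := GVW z Gz.
have {}trapO k : exists AB, trapped AB /\ trace AB = O k.
  by have [AB] := trapO k; exists AB.
have [AB ABP] := boolp.choice trapO.
pose A k := (AB k).1; pose B k := (AB k).2.
have oA k : open (A k) by have [[]] := ABP k.
have oB k : open (B k) by have [[]] := ABP k.
have AU k : closure_within U (A k) by have [[]] := ABP k.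
have BV k : closure_within V (B k) by have [[]] := ABP k.
have OE k x : O k x -> A k (set_val x) \/ B k (set_val x).
  by have [_ <-] := ABP k.
apply: (open_closure_of_separation (G := openD_head A B) (H := openD_head B A)).
- by [].
- exact: open_openD_head.
- exact: open_openD_head.
- exact: disjoint_openD_head.
- apply: (sub_closure_openD_head oU UV0 dO) => // x [k _ Okx] Ux.
  case: (OE k x Okx) => [Akx|/subset_closure/BV Vx]; first by exists k.
  by have : (U `&` V) x by []; rewrite UV0.
- rewrite setIC in UV0.
  apply: (sub_closure_openD_head oV UV0 dO) => // x [k _ Okx] Vx.
  case: (OE k x Okx) => [/subset_closure/AU Ux|Bkx]; last by exists k.
  by have : (V `&` U) x by []; rewrite UV0.
Qed.
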